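(* Let $A,C$ be any eigendirection flag pair in $\mathbb{C}^k$ constructed from eigendirections ordered as $v_1,\overline{v_1},v_2,\overline{v_2},\dots,v_m,\overline{v_m},h_1,\dots,h_n$ (so $2m+n=k$), where $v_j,\overline{v_j}$ are elliptic eigendirection pairs and the $h_j$ are hyperbolic eigendirections; thus $A$ is the flag of this ordered basis and $C$ is the flag of the reversed basis, and the number of elliptic eigendirections in $A$ is $2m$. Let $h$ be any hyperbolic eigendirection in $\mathbb{C}P^{k-1}$ such that, with $D_1=\langle h\rangle$, $A,C,D_1$ are in generic position. For a direction $\beta$ with $A,\langle\beta\rangle,C,D_1$ in generic position write $$c_j(\beta)=[A^{j,k-2-j},\langle\beta\rangle^{j,k-2-j},C^{j,k-2-j},D^{j,k-2-j}].$$ (I) A hyperbolic eigendirection $\beta$ where $A,\langle\beta\rangle,C,D_1$ are in generic position is compatible with the unique projective $\mathbb{R}$-form preserved by the eigendirections used to construct $A,C,D_1$ if and only if: 1. for each even $j<2m$, $c_j(\beta)\in S^1$; 2. for every even $j<2m$, $\arg c_j(\beta)+2\arg c_{j+1}(\beta)+\arg c_{j+2}(\beta)$ is an integral multiple of $2\pi$; 3. for each $j\ge 2m$, $c_j(\beta)\in\mathbb{R}$; 4. when $j=2m-2$ (so $k-2-j=n$ is the number of hyperbolic eigendirections in $C$), $\arg c_j(\beta)+2\arg c_{j+1}(\beta)$ is an integer multiple of $2\pi$. (II) An elliptic eigendirection pair $\beta,\beta'$ where $A,\langle\beta\rangle,C,D_1$ are in generic position and $A,\langle\beta'\rangle,C,D_1$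 are in generic position is compatible with the unique projective $\mathbb{R}$-form preserved by the eigendirections used to construct $A,C,D_1$ if and only if: 1. for each even $j<2m$, $c_j(\beta)\cdot\overline{c_j(\beta')}=1$; 2. for every odd $j<2m$, $c_j(\beta)=\overline{c_{j-1}(\beta')\,c_j(\beta')\,c_{j+1}(\beta')}$; 3. for each $j\ge 2m$, $c_j(\beta)=\overline{c_j(\beta')}$; 4. when $j=2m-1$ (so $k-2-j=n-1$ is one less than the number of hyperbolic eigendirections in $C$), $c_j(\beta')=\overline{c_{j-1}(\beta)\,c_j(\beta)}$.
   Context: Eigendirection types. The eigenvalues of (a representative of) $M\in\mathrm{PGL}_k(\mathbb{C})$ are $\mathrm{PGL}_k(\mathbb{R})$-compatible if there is a real line $\ell$ through $0$ in $\mathbb{C}$ such that all eigenvalues are either contained in $\ell$ or pairwise swapped by reflection about $\ell$. Transformations are assumed to have no repeated eigenvalues. Eigendirections with eigenvalue in $\ell$ are hyperbolic; those whose eigenvalues are swapped in pairs are elliptic, and two eigendirections with swapped eigenvalues form an elliptic eigendirection pair. Here $\overline{v_j}$ is just notation for the elliptic partner of $v_j$. An $\mathbb{R}$-form in $\mathbb{C}^k$ is the real span of a $\mathbb{C}$-basis; a projective $\mathbb{R}$-form is the image in $\mathbb{C}P^{k-1}$ of its nonzero vectors. The conjugation of an $\mathbb{R}$-form is componentwise complex conjugation in a basis whose real span it is; it induces a map of $\mathbb{C}P^{k-1}$. A hyperbolic eigendirection is compatible with a projective $\mathbb{R}$-form if it is fixed by this conjugation (equivalently, lies in the form); an elliptic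 eigendirection pair is compatible if its members are swapped by it. The projective $\mathbb{R}$-form preserved by the eigendirections used to construct $A,C,D_1$ is the one compatible with all the pairs $v_j,\overline{v_j}$ and with $h_1,\dots,h_n,h$. A flag $F$ in $\mathbb{C}^k$ is $0\subsetneq F_1\subsetneq\dots\subsetneq F_k=\mathbb{C}^k$ with $\dim F_j=j$. The flag of an ordered basis $u_1,\dots,u_k$ is $F_j=\langle u_1,\dots,u_j\rangle$. Flags (or partial flags) are in generic position if, whenever one member is chosen from each with indices summing to $k$, the sum of these members is direct and equal to $\mathbb{C}^k$; for lines such as $\langle\beta\rangle$ and $D_1$ only the indices $0,1$ occur. The cross ratio in $\mathbb{C}P^1$ is $[a,b,c,d]=\frac{(a-d)(c-b)}{(a-b)(c-d)}$. For $i+j=k-2$ with $i,j\ge 0$, the symbols $A^{i,j},\langle\beta\rangle^{i,j},C^{i,j},D^{i,j}$ denote the lines in the two-dimensional space $\mathbb{C}^k/(A_i\oplus C_j)$ given by the images of $A_{i+1}\oplus C_j$, $\langle\beta\rangle\oplus A_i\oplus C_j$, $A_i\oplus C_{j+1}$, $D_1\oplus A_i\oplus C_j$ respectively. $S^1$ is the unit circle in $\mathbb{C}$.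
   Formalization: (I).2 is required only for even j<2m with j≠2m-2, and (II).2 only for odd j<2m with j≠2m-1, condition 4 replacing them there; (I).4 and (II).4 are void when n=0. Read literally, they fail for compatible β (n≥2) or involve undefined c_j. *)

(* Defs.v *)
(* MathComp / MathComp-Analysis. *)
From HB Require Import structures.
From mathcomp Require Import all_boot all_order all_algebra.
From mathcomp Require Import boolp classical_sets reals trigo.
From mathcomp Require Import complex.

Set Implicit Arguments.
Unset Strict Implicit.
Unset Printing Implicit Defensive.

Import Order.TTheory GRing.Theory Num.Theory.

Local Open Scope classical_set_scope.
Local Open Scope ring_scope.

(* Vectors of C^k are row vectors over R[i] and matrices act on the right;
   a subspace of C^k is the row space of a matrix. *)

(* The principal argument, in ]-pi, pi] for z != 0. *)
Definition carg (R : realType) (z : R[i]) : R :=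
  let t := acos (complex.Re z /
             Num.sqrt (complex.Re z ^+ 2 + complex.Im z ^+ 2)) in
  if 0 <= complex.Im z then t else - t.

Lemma carg_polar (R : realType) (z : R[i]) : z != 0 ->
  z = `|z| * Complex (cos (carg z)) (sin (carg z)).
Proof.
case: z => a b z0; rewrite normc_def /carg /=.
set r := Num.sqrt _.
have r2 : r ^+ 2 = a ^+ 2 + b ^+ 2.
  by rewrite sqr_sqrtr // addr_ge0 // sqr_ge0.
have r0 : r != 0.
  apply: contra z0 => /eqP r0; move: r2; rewrite r0 expr0n /= => /esym/eqP.
  rewrite paddr_eq0 ?sqr_ge0 // !sqrf_eq0 => /andP[/eqP-> /eqP->].
  by rewrite eq_complex /= eqxx.
have rp : 0 < r by rewrite lt_neqAle eq_sym r0 sqrtr_ge0.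
have ar : -1 <= a / r <= 1.
  rewrite -ler_norml normrM normfV (gtr0_norm rp) ler_pdivrMr // mul1r.
  by rewrite -ler_sqr ?nnegrE ?(ltW rp) // real_normK ?num_real // r2 lerDl sqr_ge0.
have sE : Num.sqrt (1 - (a / r) ^+ 2) = `|b| / r.
  have -> : 1 - (a / r) ^+ 2 = (b / r) ^+ 2.
    apply: (mulIf (expf_neq0 2 r0)).
    by rewrite mulrBl mul1r -!exprMn !divfK // r2 addrC addKr.
  by rewrite sqrtr_sqr normrM normfV (gtr0_norm rp).
have cE : cos (acos (a / r)) = a / r by rewrite acosK // in_itv.
have sE' : sin (acos (a / r)) = `|b| / r by rewrite sin_acos.
have mulK x : r * (x / r) = x by rewrite mulrC divfK.
have [b0|b0] := leP 0 b.
  rewrite cE sE' ger0_norm //.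
  by apply/eqP; rewrite eq_complex /= !mul0r subr0 addr0 !mulK !eqxx.
rewrite cosN sinN cE sE' ltr0_norm // mulNr opprK.
by apply/eqP; rewrite eq_complex /= !mul0r subr0 addr0 !mulK !eqxx.
Qed.

(* Points of CP^(k-1): lines through 0, each represented by the canonical
   generating matrix of its span, so that = is equality of lines. *)
Record CP (R : realType) (k : nat) := MkCP {
  CPval :> 'M[R[i]]_k;
  _ : (<<CPval>>%MS == CPval) && (\rank CPval == 1)%N }.

HB.instance Definition _ (R : realType) (k : nat) :=
  [isSub for @CPval R k].
HB.instance Definition _ (R : realType) (k : nat) :=
  [Choice of CP R k by <:].

Section Transformations.
Variables (R : realType) (k : nat).
Local Notation C := R[i].
Implicit Types (M : 'M[C]_k) (w a : C) (p q : CP R k).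

(* The real line through 0 and w, and the reflection about it. *)
Definition real_line w : set C := [set a | a / w \is Num.real].
Definition reflect_line w a : C := w * (a / w)^*.

Definition no_repeated_eigenvalues M :=
  exists2 s : seq C, uniq s & char_poly M = \prod_(a <- s) ('X - a%:P).

(* Two eigenvalues are swapped by the reflection iff each one is the reflection
   of the other, so the condition is stability of the spectrum (those on the
   line are fixed by the reflection). *)
Definition PGLR_compatible M w : Prop :=
  [/\ M \in unitmx, w != 0, no_repeated_eigenvalues M &
      forall a, eigenvalue M a ->
        real_line w a \/ eigenvalue M (reflect_line w a)].

Definition hyperbolic_of M w p : Prop :=
  exists2 a, (p <= eigenspace M a)%MS & real_line w a.

Definition elliptic_pair_of M w p q : Prop :=
  exists a, [/\ (p <= eigenspace M a)%MS,
    (q <= eigenspace M (reflect_line w a))%MS & ~ real_line w a].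

Definition hyperbolic_eigendirection p : Prop :=
  exists M w, PGLR_compatible M w /\ hyperbolic_of M w p.

Definition elliptic_eigendirection_pair p q : Prop :=
  exists M w, PGLR_compatible M w /\ elliptic_pair_of M w p q.

Definition ordered_dirs (m n : nat) (v vbar : 'I_m -> CP R k)
    (hyp : 'I_n -> CP R k) : seq (CP R k) :=
  flatten [seq [:: v i; vbar i] | i <- enum 'I_m]
  ++ [seq hyp i | i <- enum 'I_n].

(* With 2 m + n = k, [uniq] makes the list exhaust the eigendirections of M. *)
Definition eigendirection_system (m n : nat) (v vbar : 'I_m -> CP R k)
    (hyp : 'I_n -> CP R k) : Prop :=
  exists M w, [/\ PGLR_compatible M w,
    forall i, elliptic_pair_of M w (v i) (vbar i),
    forall i, hyperbolic_of M w (hyp i) &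
    uniq (ordered_dirs v vbar hyp)].

End Transformations.

Section RForms.
Variables (R : realType) (k : nat).
Local Notation C := R[i].
Implicit Types (B : 'M[C]_k) (F : set (CP R k)) (p q : CP R k).

(* The real span of the rows of B. *)
Definition Rform B : set 'rV[C]_k :=
  [set x | exists r : 'rV[R]_k, x = map_mx (real_complex R) r *m B].

Definition proj_Rform B : set (CP R k) :=
  [set p | exists2 x, Rform B x /\ x != 0 & (p == x)%MS].

(* Componentwise conjugation in the basis given by the rows of B, applied to
   each row of U. *)
Definition Rform_conj B (l : nat) (U : 'M[C]_(l, k)) : 'M[C]_(l, k) :=
  map_mx Num.conj (U *m invmx B) *m B.

Definition is_proj_Rform F : Prop :=
  exists2 B, B \in unitmx & F = proj_Rform B.

(* The map induced on CP^(k-1) by the conjugation does not depend on the basis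
   B chosen for F. *)
Definition hyperbolic_compatible F p : Prop :=
  exists B, [/\ B \in unitmx, F = proj_Rform B & (Rform_conj B p == p)%MS].

Definition elliptic_compatible F p q : Prop :=
  exists B, [/\ B \in unitmx, F = proj_Rform B,
    (Rform_conj B p == q)%MS & (Rform_conj B q == p)%MS].

Definition preserved_Rform (m n : nat) (v vbar : 'I_m -> CP R k)
    (hyp : 'I_n -> CP R k) (h : CP R k) F : Prop :=
  [/\ is_proj_Rform F,
      forall i, elliptic_compatible F (v i) (vbar i),
      forall i, hyperbolic_compatible F (hyp i) &
      hyperbolic_compatible F h].

End RForms.

(* A (partial) flag: the member [pf_mem j] for 0 <= j <= pf_top; members with
   larger index are irrelevant. *)
Record pflag (R : realType) (k : nat) := PFlag {
  pf_top : nat;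
  pf_mem :> nat -> 'M[R[i]]_k }.

Section Flags.
Variables (R : realType) (k : nat).
Local Notation C := R[i].

Definition flag_of (s : seq (CP R k)) : pflag R k :=
  PFlag (size s) (fun j => \sum_(p <- take j s) (p : 'M_k))%MS.

Definition line_flag (p : CP R k) : pflag R k :=
  PFlag 1 (fun j => if j == 0%N then 0 else p : 'M_k).

Definition generic_position (Fs : seq (pflag R k)) : Prop :=
  forall idx : 'I_(size Fs) -> nat,
    (forall s, (idx s <= pf_top (tnth (in_tuple Fs) s))%N) ->
    (\sum_s idx s)%N = k ->
    mxdirect (\sum_s tnth (in_tuple Fs) s (idx s))%MS /\
    row_full (\sum_s tnth (in_tuple Fs) s (idx s))%MS.

(* Four points of CP^1 in homogeneous coordinates (the affine coordinate of
   (x0, x1) is x0 / x1, infinity being allowed); the denominators coming from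
   the four differences cancel. *)
Definition cross_ratio_rV (a b c d : 'rV[C]_2) : C :=
  let dif (x y : 'rV[C]_2) := x 0 0 * y 0 1 - x 0 1 * y 0 0 in
  (dif a d * dif c b) / (dif a b * dif c d).

Lemma cross_ratio_affine (a b c d : C) :
  let pt (z : C) : 'rV[C]_2 := \row_i (if i == 0 then z else 1) in
  cross_ratio_rV (pt a) (pt b) (pt c) (pt d) =
    ((a - d) * (c - b)) / ((a - b) * (c - d)).
Proof.
by move=> pt; rewrite /cross_ratio_rV !mxE /= !mulr1 !mul1r.
Qed.

(* For lines of C^2 given as row spaces; independent of the chosen vectors. *)
Definition cross_ratio (l : nat) (a b c d : 'M[C]_(l, 2)) : C :=
  cross_ratio_rV (nz_row a) (nz_row b) (nz_row c) (nz_row d).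

(* The quotient map C^k -> C^k / W followed by an isomorphism of C^k / W with
   C^2, when W has codimension 2 (and 0 otherwise). *)
Definition quot2 (W : 'M[C]_k) : 'M[C]_(k, 2) :=
  conform_mx 0 (col_base (cokermx W)).

Lemma quot2P (W : 'M[C]_k) : (\rank W + 2 = k)%N ->
  \rank (quot2 W) = 2 /\
  forall l (U : 'M[C]_(l, k)), (U *m quot2 W == 0) = (U <= W)%MS.
Proof.
move=> rW.
have r2 : \rank (cokermx W) = 2 by rewrite mxrank_coker -{1}rW addKn.
rewrite /quot2.
have fA := col_base_full (cokermx W); have fB := row_base_free (cokermx W).
have eW := mulmx_base (cokermx W).
move: (col_base _) (row_base _) fA fB eW; rewrite r2 => A B fA fB eW.
rewrite conform_mx_id; split; first exact/eqP.
move=> l U; rewrite submxE -eW mulmxA; apply/eqP/eqP => [->|UA0].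
  by rewrite mul0mx.
by apply: (row_free_inj fB); rewrite UA0 mul0mx.
Qed.

Definition proj_cross_ratio (A Cf : pflag R k) (D1 b : CP R k) (i j : nat) : C :=
  let W := (A i + Cf j)%MS in
  let im (U : 'M[C]_k) := U *m quot2 W in
  cross_ratio (im (A i.+1 + Cf j)%MS) (im (b + W)%MS)
              (im (A i + Cf j.+1)%MS) (im (D1 + W)%MS).

End Flags.

(* Main.v *)
(** Scale the basis of eigendirections so that [h] has coordinates (1, ..., 1).
    If [beta] is the coordinate vector of a direction, its projections to
    C^k / (A_j + C_(k-2-j)) only see the coordinates j and j+1, and
    c_j = beta_j / beta_(j+1).  The real form must swap the two lines of every
    elliptic pair and fix the hyperbolic lines and (1, ..., 1); k + 1 lines in
    general position determine an antilinear map up to a scalar, so its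
    conjugation is x |-> conj x followed by the permutation tau swapping
    partners.  Hence compatibility of [b] and [b'] says that the ratios
    conj (beta_(tau s)) / beta'_s do not depend on s; comparing the ratios at
    consecutive s gives the listed conditions on the c_j. *)
Require Import Defs.
From HB Require Import structures.
From mathcomp Require Import all_boot all_order all_algebra.
From mathcomp Require Import boolp classical_sets reals trigo.
From mathcomp Require Import complex perm.
From mathcomp Require Import ring lra zify.

Set Implicit Arguments.
Unset Strict Implicit.
Unset Printing Implicit Defensive.

Import Order.TTheory GRing.Theory Num.Theory.

Local Open Scope ring_scope.

(** * Arguments modulo [2 * pi] and positivity of complex numbers *)

Lemma cosDz2pi (R : realType) (z : int) (t : R) : cos (t + z%:~R * (2 * pi)) = cos t.
Proof.
rewrite mulr_natl.
have cosDn (n : nat) (u : R) : cos (u + n%:R * (pi *+ 2)) = cos u.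
  elim: n u => [|n IHn] u; first by rewrite mul0r addr0.
  by rewrite -[n.+1]addn1 natrD mulrDl mul1r addrA cosD2pi IHn.
case: z => n; first exact: cosDn.
by rewrite NegzE mulrNz mulNr -(cosDn n.+1) subrK.
Qed.

(** After reduction of [s] modulo [2 * pi] to [t] in [[0, 2 pi)], a positive [t] would give
    [sin (t / 2) > 0], hence [cos t = 1 - 2 sin (t / 2) ^ 2 < 1]. *)
Lemma cos_eq1 (R : realType) (s : R) :
  cos s = 1 <-> exists z : int, s = z%:~R * (2 * pi).
Proof.
split=> [s1|[z ->]]; last by rewrite -[_ * _]add0r cosDz2pi cos0.
have pi0 : 0 < 2 * pi :> R by rewrite mulr_gt0 // pi_gt0.
exists (Num.floor (s / (2 * pi))).
set z := Num.floor _; set t := s - z%:~R * (2 * pi).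
have t1 : cos t = 1 by rewrite -(cosDz2pi z) subrK.
have t0 : 0 <= t by rewrite subr_ge0 -ler_pdivlMr // floor_le.
have t2 : t < 2 * pi.
  rewrite ltrBlDr -[X in X + _]mul1r -mulrDl -ltr_pdivrMr //.
  by rewrite -[X in X + _]/(1%:~R) -intrD addrC floorD1_gt.
move: t0; rewrite le_eqVlt => /predU1P[/esym/eqP|t0]; first by rewrite subr_eq0 => /eqP.
have : 0 < sin (t / 2).
  by apply: sin_gt0_pi; rewrite divr_gt0 //= ltr_pdivrMr // mulrC.
move: t1; rewrite [t in cos t](_ : _ = (t / 2) *+ 2); last by rewrite mulr2n -splitr.
rewrite cos_mulr2n cos2sin2 => s0 sp; have := exprn_gt0 2 sp; lra.
Qed.

Definition cis (R : realType) (t : R) : R[i] := Complex (cos t) (sin t).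

Lemma cisD (R : realType) (s t : R) : cis (s + t) = cis s * cis t.
Proof. by apply/eqP; rewrite eq_complex /= cosD sinD [sin s * _ + _]addrC !eqxx. Qed.

(** In the order of [R[i]], [0 < z] means that [z] is real with positive real part; on the unit
    circle only the point 1 qualifies. *)
Lemma cis_gt0 (R : realType) (s : R) :
  (0 < cis s) <-> exists z : int, s = z%:~R * (2 * pi).
Proof.
rewrite -cos_eq1 ltcE /=; split=> [/andP[/eqP s0 c0]|c1].
  have := cos2Dsin2 s; rewrite s0 expr0n addr0 => /eqP.
  by rewrite sqrf_eq1 => /orP[/eqP //|/eqP cN]; move: c0; rewrite cN oppr_gt0 ltr10.
by rewrite c1 ltr01 andbT -sqrf_eq0 sin2cos2 c1 expr1n subrr.
Qed.

(** Turns a congruence between arguments into positivity of a product, where the moduli are harmless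
    positive factors; the criteria below can then be checked by field algebra. *)
Lemma carg_mul3_gt0 (R : realType) (x y t : R[i]) : x != 0 -> y != 0 -> t != 0 ->
  0 < x * y ^+ 2 * t <->
  exists z : int, carg x + 2 * carg y + carg t = z%:~R * (2 * pi).
Proof.
move=> x0 y0 t0; rewrite -cis_gt0 mulr_natl mulr2n !cisD.
have polar (z : R[i]) : z != 0 -> z = `|z| * cis (carg z) := @carg_polar R z.
have -> : x * y ^+ 2 * t = (`|x| * `|y| ^+ 2 * `|t|) *
    (cis (carg x) * (cis (carg y) * cis (carg y)) * cis (carg t)).
  rewrite {1}(polar x x0) {1}(polar y y0) {1}(polar t t0).
  move: `|x| `|y| `|t| (cis _) (cis _) (cis _) => *; ring.
by rewrite pmulr_rgt0 // !mulr_gt0 ?exprn_gt0 ?normr_gt0.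
Qed.

Lemma carg_mul2_gt0 (R : realType) (x y : R[i]) : x != 0 -> y != 0 ->
  0 < x * y ^+ 2 <-> exists z : int, carg x + 2 * carg y = z%:~R * (2 * pi).
Proof.
move=> x0 y0; have c1 : carg (1 : R[i]) = 0.
  by rewrite /carg /= lexx expr1n expr0n addr0 sqrtr1 divr1 acos1.
by have := carg_mul3_gt0 x0 y0 (oner_neq0 _); rewrite c1 mulr1 addr0.
Qed.

(** * Partners, and the criteria on consecutive quotients of coordinates *)

(* The 0-based position of the elliptic partner of the s-th direction; the
   directions at positions s >= 2 m are hyperbolic. *)
Definition partner (m s : nat) : nat :=
  if (s < 2 * m)%N then (if odd s then s.-1 else s.+1) else s.

Lemma partnerK m : involutive (partner m).
Proof.
move=> s; rewrite /partner; have [s2|s2] := ltnP s (2 * m); last by rewrite ltnNge s2.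
have ->: odd (if odd s then s.-1 else s.+1) = ~~ odd s.
  by case: s {s2} => [|s] //=; case o: (odd s); rewrite /= ?o.
have [o|e] /= := boolP (odd s).
  by rewrite (leq_ltn_trans (leq_pred s)) // prednK // odd_gt0.
by rewrite ifT //; lia.
Qed.

Lemma partner_even m s : (s < 2 * m)%N -> ~~ odd s -> partner m s = s.+1.
Proof. by rewrite /partner => -> /negbTE->. Qed.

Lemma partner_odd m s : (s.+1 < 2 * m)%N -> ~~ odd s -> partner m s.+1 = s.
Proof. by rewrite /partner /= => -> ->. Qed.

Lemma partner_big m s : (2 * m <= s)%N -> partner m s = s.
Proof. by rewrite /partner ltnNge => ->. Qed.

Lemma partner_lt m n s : (s < 2 * m + n)%N -> (partner m s < 2 * m + n)%N.
Proof. by rewrite /partner; case: ifP => //; case: ifP; lia. Qed.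

Lemma const_below (T : Type) (q : nat -> T) (k : nat) :
  (exists l, forall s, (s < k)%N -> q s = l) <->
  (forall s, (s.+1 < k)%N -> q s = q s.+1).
Proof.
split=> [[l ql] s sk|H]; first by rewrite !ql // ltnW.
exists (q 0%N); elim=> [//|s IHs] sk.
by rewrite -(H _ sk) (IHs (ltnW sk)).
Qed.

(** Both sides say that [x] and [y] have the same argument, since the quotient of the modulus of [x]
    by [x] is the inverse of the phase of [x]. *)
Lemma eq_polar_gt0 (C : numClosedFieldType) (x y : C) : x != 0 -> y != 0 ->
  `|x| / x = `|y| / y <-> 0 < x / y.
Proof.
move=> x0 y0; have nx : `|x| != 0 by rewrite normr_eq0.
have ny : `|y| != 0 by rewrite normr_eq0.
split=> [/eqP|p].
  rewrite eqr_div // => /eqP e.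
  have /eqP -> : x / y == `|x| / `|y| by rewrite eqr_div // e mulrC.
  by rewrite divr_gt0 ?normr_gt0.
have := gtr0_norm p; rewrite normrM normfV => /eqP; rewrite eqr_div // => /eqP e.
by apply/eqP; rewrite eqr_div // e mulrC.
Qed.

(* Given |f s| = |f (partner m s)|, the ratio q s equals |g s| / g s with
   g s = f s * f (partner m s). *)
Lemma self_partner_conj_criterion (R : realType) (m n : nat) (f c : nat -> R[i]) :
  (forall s, (s < 2 * m + n)%N -> f s != 0) ->
  (forall s, (s.+1 < 2 * m + n)%N -> c s = f s / f s.+1) ->
  (exists l, forall s, (s < 2 * m + n)%N -> (f (partner m s))^* / f s = l) <->
  [/\ forall j, ~~ odd j -> (j < 2 * m)%N -> `|c j| = 1,
      forall j, ~~ odd j -> (j < 2 * m)%N -> (j + 2 <> 2 * m)%N ->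
        exists z : int, carg (c j) + 2 * carg (c j.+1) + carg (c j.+2)
            = z%:~R * (2 * pi),
      forall j, (2 * m <= j)%N -> (j + 2 <= 2 * m + n)%N -> c j \is Num.real &
      forall j, (j + 2 = 2 * m)%N -> (0 < n)%N ->
        exists z : int, carg (c j) + 2 * carg (c j.+1) = z%:~R * (2 * pi)].
Proof.
set k := (2 * m + n)%N => f0 cE.
have c0 s : (s.+1 < k)%N -> c s != 0.
  by move=> sk; rewrite cE // mulf_neq0 ?invr_eq0 ?f0 // ltnW.
pose q s := (f (partner m s))^* / f s; pose g s := f s * f (partner m s).
have pk s : (s < k)%N -> (partner m s < k)%N by apply: partner_lt.
have g0 s : (s < k)%N -> g s != 0 by move=> sk; rewrite mulf_neq0 ?f0 ?pk.
have normN : (forall j, ~~ odd j -> (j < 2 * m)%N -> `|f j| = `|f j.+1|) <->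
    (forall j, ~~ odd j -> (j < 2 * m)%N -> `|c j| = 1).
  split=> H j ej jm; have jk : (j.+1 < k)%N by rewrite /k; lia.
    by rewrite cE // normrM normfV -H // divff // normr_eq0 f0 // ltnW.
  have := H j ej jm; rewrite cE // normrM normfV => /(congr1 ( *%R^~ `|f j.+1|)).
  by rewrite divfK ?mul1r // normr_eq0 f0.
apply: (iff_trans (const_below q k)).
(* Multiplying numerator and denominator of [q s] by [f (partner m s)] gives a squared modulus over
   [g s]; equal moduli of partners make that square the modulus of [g s]. Equality of [q s] and
   [q t] thus becomes equality of the phases of [g s] and [g t]. *)
have gE : (forall j, ~~ odd j -> (j < 2 * m)%N -> `|f j| = `|f j.+1|) ->
    forall s t, (s < k)%N -> (t < k)%N -> q s = q t <-> 0 < g s / g t.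
  move=> N; have qE s : (s < k)%N -> q s = `|g s| / g s.
    move=> sk; have nE : `|f s| = `|f (partner m s)|.
      have [s2|s2] := leqP (2 * m) s; first by rewrite partner_big.
      have [os|es] := boolP (odd s); last by rewrite partner_even // N.
      case: s os s2 {sk} => // s es s2.
      by rewrite partner_odd // (N s) //; lia.
    rewrite /q /g; apply/eqP; rewrite eqr_div ?f0 ?mulf_neq0 ?f0 ?pk //.
    by rewrite normrM nE -expr2 normCK; apply/eqP; ring.
  by move=> s t sk tk; rewrite !qE //; apply: eq_polar_gt0; apply: g0.
have gg j : ~~ odd j -> (j < 2 * m)%N -> g j = g j.+1.
  move=> ej jm; have jm1 : (j.+1 < 2 * m)%N by lia.
  by rewrite /g partner_even // partner_odd // mulrC.
(* For two consecutive elliptic pairs the quotient is [f_j f_(j+1) / (f_(j+2) f_(j+3))]; writing it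
   with the [c]'s counts the middle quotient twice, whence the coefficient 2 in the argument
   condition. *)
have gg3 j : ~~ odd j -> (j.+2 < 2 * m)%N ->
    g j / g j.+2 = c j * c j.+1 ^+ 2 * c j.+2.
  move=> ej jm; have jm1 : (j.+3 < 2 * m)%N by lia.
  rewrite /g (partner_even (s := j)) ?(partner_even jm) //=; try lia.
  rewrite !cE; try by rewrite /k; lia.
  by field; rewrite !f0 // /k; lia.
(* At the border the position [j.+2 = 2 * m] is its own partner, so that [g j.+2] is a square and no
   third quotient appears. *)
have gg2 j : (j.+2 = 2 * m)%N -> (0 < n)%N -> g j / g j.+2 = c j * c j.+1 ^+ 2.
  move=> jm n0; rewrite /g partner_even; [|lia|lia].
  rewrite partner_big ?jm // !cE -?jm; try by rewrite /k; lia.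
  by field; rewrite !f0 // /k; lia.
(* Between hyperbolic positions the quotient is a square, and a nonzero number is real exactly when
   its square is positive. *)
have gg1 j : (2 * m <= j)%N -> (j.+1 < k)%N -> g j / g j.+1 = c j ^+ 2.
  move=> jm jk; rewrite /g !partner_big ?cE //; last exact: leqW.
  by field; rewrite f0.
split=> [Q|[/normN N C2 C3 C4] s sk].
  (* Cross-multiplying [q j = q j.+1] inside a pair equates the squared moduli of [f j] and
     [f j.+1]. *)
  have N j : ~~ odd j -> (j < 2 * m)%N -> `|f j| = `|f j.+1|.
    move=> ej jm; have jm1 : (j.+1 < 2 * m)%N by lia.
    have jk : (j.+1 < k)%N by rewrite /k; lia.
    have /eqP := Q j jk; rewrite /q partner_even // partner_odd //.
    rewrite eqr_div ?f0 //; last exact: ltnW.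
    by rewrite -!normCKC eqrXn2 ?normr_ge0 // => /eqP ->.
  have {}gE := gE N.
  split=> [|j ej jm jm2|j jm jk|j jm n0]; first exact/normN.
  - apply/carg_mul3_gt0; try by apply: c0; rewrite /k; lia.
    rewrite -gg3 //; last lia.
    by apply/gE; [| |rewrite (Q j) ?(Q j.+1)]; rewrite /k //; lia.
  - rewrite realEsqr -gg1 ?ltW //; try by rewrite /k; lia.
    by apply/gE; [| |rewrite (Q j)]; rewrite /k //; lia.
  apply/carg_mul2_gt0; try by apply: c0; rewrite /k; lia.
  rewrite -gg2 //; last lia.
  by apply/gE; [| |rewrite (Q j) ?(Q j.+1)]; rewrite /k //; lia.
have {}gE := gE N.
have q01 j : ~~ odd j -> (j < 2 * m)%N -> q j = q j.+1.
  move=> ej jm; apply/gE; try by rewrite /k; lia.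
  by rewrite -gg // divff ?ltr01 // g0 // /k; lia.
have [s2|s2] := leqP (2 * m) s.
  apply/gE => //; first exact: ltnW.
  by rewrite gg1 // lt0r expf_neq0 ?c0 //= -realEsqr C3 ?addn2.
have [os|es] := boolP (odd s); last exact: q01.
(* The comparison leaving an elliptic pair is moved back to the even member of that pair, so that it
   becomes [q s = q s.+2] with [s] even, the shape covered by [gg3] and [gg2]. *)
case: s os s2 sk => // s es s2 sk; rewrite -q01 //; last exact: ltnW.
apply/gE; try by rewrite /k; lia.
have [s3|s3] := leqP (2 * m) s.+2.
  have e : s.+2 = (2 * m)%N by lia.
  have n0 : (0 < n)%N by move: sk; rewrite /k; lia.
  rewrite gg2 //; apply/carg_mul2_gt0; try by apply: c0; rewrite /k; lia.
  by apply: C4; rewrite ?addn2.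
rewrite gg3 //; apply/carg_mul3_gt0; try by apply: c0; rewrite /k; lia.
by apply: C2 => //; lia.
Qed.

(** Each listed identity is one equality between two values of [q], after conjugation and
    cross-multiplication. They link [j] to [j + 1] inside a pair, the outer members [i] and [i + 3]
    of two adjacent pairs, the last elliptic position to the first hyperbolic one, and consecutive
    hyperbolic positions; together these links connect all positions. *)
Lemma conj_partner_criterion (C : numClosedFieldType) (m n : nat)
    (f f' c c' : nat -> C) :
  (forall s, (s < 2 * m + n)%N -> f s != 0) ->
  (forall s, (s < 2 * m + n)%N -> f' s != 0) ->
  (forall s, (s.+1 < 2 * m + n)%N -> c s = f s / f s.+1) ->
  (forall s, (s.+1 < 2 * m + n)%N -> c' s = f' s / f' s.+1) ->
  (exists l, forall s, (s < 2 * m + n)%N -> (f (partner m s))^* / f' s = l) <->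
  [/\ forall j, ~~ odd j -> (j < 2 * m)%N -> c j * (c' j)^* = 1,
      forall j, odd j -> (j < 2 * m)%N -> (j + 1 <> 2 * m)%N ->
        c j = (c' j.-1 * c' j * c' j.+1)^*,
      forall j, (2 * m <= j)%N -> (j + 2 <= 2 * m + n)%N -> c j = (c' j)^* &
      forall j, (j + 1 = 2 * m)%N -> (0 < n)%N -> c' j = (c j.-1 * c j)^*].
Proof.
set k := (2 * m + n)%N => f0 f'0 cE c'E.
pose q s := (f (partner m s))^* / f' s.
have qq s t : (s < k)%N -> (t < k)%N ->
    q s = q t <-> (f (partner m s))^* * f' t = (f (partner m t))^* * f' s.
  move=> sk tk; rewrite /q; split=> [/eqP|e].
    by rewrite eqr_div ?f'0 // => /eqP.
  by apply/eqP; rewrite eqr_div ?f'0 // e.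
have flip (a b : C) : a = b^* <-> b = a^* by split=> ->; rewrite conjCK.
have cross (a b x y : C) : b != 0 -> y != 0 ->
    a / b = (x / y)^* <-> a^* * y = b^* * x.
  move=> b0 y0; apply: (iff_trans (flip _ _)); rewrite rmorphM fmorphV.
  have b1 : b^* != 0 by rewrite conjC_eq0.
  split=> [/eqP|e]; first by rewrite eqr_div // => /eqP e; rewrite -e mulrC.
  by apply/eqP; rewrite eqr_div // e mulrC.
have E1 j : ~~ odd j -> (j < 2 * m)%N -> c j * (c' j)^* = 1 <-> q j = q j.+1.
  move=> ej jm; have jm1 : (j.+1 < 2 * m)%N by lia.
  have jk : (j.+1 < k)%N by rewrite /k; lia.
  have c'j : c j = (f' j.+1 / f' j)^* <-> q j = q j.+1.
    rewrite cE //; apply: (iff_trans (cross _ _ _ _ _ _)); rewrite ?f0 ?f'0 ?(ltnW jk) //.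
    apply: iff_sym; apply: (iff_trans (qq _ _ _ _)); rewrite ?(ltnW jk) //.
    by rewrite partner_even // partner_odd //; split=> ->.
  apply: iff_trans c'j; rewrite c'E // -(invf_div (f' j)) fmorphV.
  have d0 : (f' j / f' j.+1)^* != 0.
    by rewrite conjC_eq0 mulf_neq0 ?invr_eq0 ?f'0 // ltnW.
  split=> [e|->]; last by rewrite mulVf.
  by rewrite -[RHS]mul1r -e mulfK.
have E2 i : ~~ odd i -> (i.+2 < 2 * m)%N ->
    c i.+1 = (c' i * c' i.+1 * c' i.+2)^* <-> q i = q i.+3.
  move=> ei im; have im1 : (i.+3 < 2 * m)%N by lia.
  have ik : (i.+3 < k)%N by rewrite /k; lia.
  (* The product telescopes to the outer positions, whose partners [i.+1] and [i.+2] are exactly the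
     positions entering [c i.+1]. *)
  have -> : c' i * c' i.+1 * c' i.+2 = f' i / f' i.+3.
    by rewrite !c'E; try lia; field; rewrite !f'0 //; lia.
  rewrite cE //; last lia.
  apply: (iff_trans (cross _ _ _ _ _ _)); rewrite ?f0 ?f'0 //; try lia.
  apply: iff_sym; apply: (iff_trans (qq _ _ _ _)) => //; first lia.
  by rewrite partner_even ?partner_odd /= ?negbK //; lia.
have E3 j : (2 * m <= j)%N -> (j.+1 < k)%N -> c j = (c' j)^* <-> q j = q j.+1.
  move=> jm jk; rewrite cE // c'E //.
  apply: (iff_trans (cross _ _ _ _ _ _)); rewrite ?f0 ?f'0 //.
  apply: iff_sym; apply: (iff_trans (qq _ _ _ _)) => //; first exact: ltnW.
  by rewrite !partner_big // leqW.
have E4 i : ~~ odd i -> (i.+2 = 2 * m)%N -> (0 < n)%N ->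
    c' i.+1 = (c i * c i.+1)^* <-> q i.+1 = q i.+2.
  move=> ei im n0; have ik : (i.+2 < k)%N by rewrite /k; lia.
  apply: (iff_trans (flip _ _)).
  have -> : c i * c i.+1 = f i / f i.+2.
    by rewrite !cE; try lia; field; rewrite !f0 //; lia.
  rewrite c'E //; apply: (iff_trans (cross _ _ _ _ _ _)); rewrite ?f0 ?f'0 //.
  apply: iff_sym; apply: (iff_trans (qq _ _ _ _)) => //; first lia.
  by rewrite partner_odd ?partner_big //; lia.
apply: (iff_trans (const_below q k)).
split=> [Q|[C1 C2 C3 C4] s sk].
  split=> [j ej jm|j oj jm jm1|j jm jk|j jm n0].
  - by apply/E1 => //; apply: Q; rewrite /k; lia.
  - case: j oj jm jm1 => // i ei im im1.
    by apply/E2 => //; [lia|rewrite (Q i) ?(Q i.+1) ?(Q i.+2)]; rewrite /k //; lia.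
  - by apply/E3 => //; [lia|apply: Q; lia].
  - case: j jm => [|i im]; first lia.
    by apply/E4 => //; [lia|lia|apply: Q; rewrite /k; lia].
have [s2|s2] := leqP (2 * m) s; first by apply/E3 => //; apply: C3; lia.
have [os|es] := boolP (odd s); last by apply/E1 => //; apply: C1.
case: s os s2 sk => // i ei im sk.
have [s3|s3] := leqP (2 * m) i.+2.
  apply/E4 => //; [lia|move: sk; rewrite /k; lia|apply: C4; last by move: sk; rewrite /k; lia].
  by lia.
(* The equality of the inner neighbours [i.+1] and [i.+2] is reached through the outer ones:
   [q i.+1 = q i = q i.+3 = q i.+2]. *)
have e1 : q i = q i.+1 by apply/E1 => //; [lia | apply: C1 => //; lia].
have e2 : q i.+2 = q i.+3 by apply/E1; [rewrite /= negbK|lia|apply: C1; rewrite /= ?negbK].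
rewrite -e1 e2; apply/E2 => //; apply: C2 => //; lia.
Qed.

(** * Real forms and the matrices of their conjugations *)

Section RealForms.
Variables (R : realType) (k : nat).
Local Notation C := R[i].
Implicit Types (B X K : 'M[C]_k) (p q : CP R k).

Lemma CP_rank1 p : \rank p = 1%N.
Proof. by case: p => M /= /andP[_ /eqP]. Qed.

Lemma CP_neq0 p : p != 0 :> 'M_k.
Proof. by rewrite -mxrank_eq0 CP_rank1. Qed.

Lemma CP_nz_row p : (p :=: nz_row p)%MS.
Proof.
apply: eqmx_sym; apply/eqmxP; rewrite -(mxrank_leqif_eq (nz_row_sub p)).
by rewrite rank_rV nz_row_eq0 CP_neq0 CP_rank1.
Qed.

Lemma CP_gt0 p : (0 < k)%N.
Proof. by have := rank_leq_row p; rewrite CP_rank1. Qed.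

Definition conjmx (m n : nat) (U : 'M[C]_(m, n)) := map_mx Num.conj U.

Lemma conjmxK (m n : nat) : involutive (@conjmx m n).
Proof. by move=> U; apply/matrixP=> i j; rewrite !mxE conjCK. Qed.

Lemma conjmxM (m n r : nat) (U : 'M[C]_(m, n)) (V : 'M_(n, r)) :
  conjmx (U *m V) = conjmx U *m conjmx V.
Proof. exact: map_mxM. Qed.

Lemma conjmx1 : conjmx (1%:M : 'M_k) = 1%:M.
Proof. exact: map_mx1. Qed.

Lemma conjmx_unit X : (conjmx X \in unitmx) = (X \in unitmx).
Proof. exact: map_unitmx. Qed.

Lemma eqmx_conj (m1 m2 n : nat) (U : 'M[C]_(m1, n)) (V : 'M_(m2, n)) :
  (conjmx U == conjmx V)%MS = (U == V)%MS.
Proof. by rewrite !map_submx. Qed.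

Lemma eqmx_mulr (m1 m2 n r : nat) (U : 'M[C]_(m1, n)) (V : 'M_(m2, n)) (W : 'M_(n, r)) :
  (U :=: V)%MS -> (U *m W :=: V *m W)%MS.
Proof. by move=> UV; apply/eqmxP; rewrite !submxMr ?UV. Qed.

(** Splits the conjugation of the form into entrywise conjugation in the standard coordinates
    followed by a linear map, so that conjugations coming from different bases can be compared as
    matrices. *)
Definition conj_mx_of B : 'M_k := conjmx (invmx B) *m B.

Lemma Rform_conjE B (l : nat) (U : 'M_(l, k)) :
  Rform_conj B U = conjmx U *m conj_mx_of B.
Proof. by rewrite /Rform_conj -/(conjmx _) conjmxM mulmxA. Qed.

(** If the conjugation fixes a line, the coordinate vector [y] of a generator satisfies
    [conj y = l y]; the ratios of its entries are then real, and dividing by a nonzero entry gives a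
    real generator of the same line. *)
Lemma mem_proj_RformP B p : B \in unitmx ->
  proj_Rform B p <-> (conjmx p *m conj_mx_of B == p)%MS.
Proof.
move=> uB; have conjB : conjmx B *m conj_mx_of B = B.
  by rewrite /conj_mx_of mulmxA -conjmxM mulmxV // conjmx1 mul1mx.
split=> [[x [[r xE] x0] px]|pK].
  have conjx : conjmx x *m conj_mx_of B = x.
    rewrite xE conjmxM -mulmxA conjB; congr (_ *m _).
    by apply/matrixP=> i j; rewrite !mxE; apply/eqP; rewrite eq_complex /= oppr0 !eqxx.
  apply/eqmxP; apply: eqmx_trans (eqmx_sym (eqmxP px)).
  by rewrite -[X in (_ :=: X)%MS]conjx; apply: eqmx_mulr; apply/eqmxP; rewrite eqmx_conj.
set y := nz_row p *m invmx B.
have yB : y *m B = nz_row p by rewrite mulmxKV.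
clearbody y.
have y0 : y != 0.
  by apply: contraNneq (CP_neq0 p) => y0; rewrite -nz_row_eq0 -yB y0 mul0mx.
have /sub_rVP[l ly] : (conjmx y <= y)%MS.
  have: (conjmx (nz_row p) *m conj_mx_of B <= nz_row p)%MS.
    rewrite -(CP_nz_row p) -(eqmxP pK) submxMr // map_submx.
    by rewrite (CP_nz_row p).
  rewrite -yB conjmxM -mulmxA conjB => /submxP[D e].
  apply/submxP; exists D; apply: (can_inj (mulmxK uB)).
  by rewrite e mulmxA.
have [i yi0] : exists i, y 0 i != 0.
  by apply/existsP; apply: contraNT y0 => /existsPn H; apply/eqP/rowP=> i; rewrite mxE;
     apply/eqP; move: (H i); rewrite negbK.
have real_quot j : (y 0 j / y 0 i)^* = y 0 j / y 0 i.
  have le j' : (y 0 j')^* = l * y 0 j'.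
    by move/rowP/(_ j'): (ly); rewrite !mxE.
  have l0 : l != 0.
    by apply: contraNneq yi0 => l0; rewrite -conjC_eq0 le l0 mul0r.
  by rewrite rmorphM fmorphV /= !le -mulf_div divff // mul1r.
exists (((y 0 i)^-1 *: y) *m B).
  split; last first.
    rewrite -scalemxAl scaler_eq0 invr_eq0 (negbTE yi0) yB nz_row_eq0.
    by rewrite (negbTE (CP_neq0 p)).
  exists (\row_j complex.Re (y 0 j / y 0 i)); congr (_ *m _).
  apply/rowP=> j; rewrite !mxE mulrC; have /eqP := real_quot j.
  move: (y 0 j / y 0 i) => [a b]; rewrite eq_complex /= => /andP[_ /eqP e].
  apply/eqP; rewrite eq_complex /= eqxx /=; apply/eqP; lra.
apply/eqmxP; rewrite -scalemxAl yB.
by apply: eqmx_trans (CP_nz_row p) (eqmx_sym (eqmx_scale _ _)); rewrite invr_eq0.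
Qed.

End RealForms.

(** * Antilinear maps determined by a projective frame *)

Section Rigidity.
Variables (R : realType) (k : nat).
Local Notation C := R[i].
Implicit Types (B X K : 'M[C]_k) (p q h : CP R k) (s : 'S_k).

(* k + 1 lines in general position determine an antilinear map up to a
   scalar. *)
Lemma conj_frame_rigid X K s : (0 < k)%N -> X \in unitmx ->
  (forall i, (conjmx (row i X) *m K == row (s i) X)%MS) ->
  (conjmx (const_mx 1 *m X : 'rV_k) *m K == (const_mx 1 *m X : 'rV_k))%MS ->
  exists2 l : C, l != 0 & K = l *: (conjmx (invmx X) *m perm_mx s *m X).
Proof.
move=> k0 uX rX sX; have uX' : conjmx X \in unitmx by rewrite conjmx_unit.
(* [Q] is the matrix of the antilinear map in the basis of rows of [X]; the conditions on the rows
   make it vanish outside the pattern of [s]. *)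
pose Q := conjmx X *m K *m invmx X.
have Qoff i j : j != s i -> Q i j = 0.
  move=> ji; have /andP[/sub_rVP[a ra] _] := rX i.
  have -> : Q i j = row i Q 0 j by rewrite [RHS]mxE.
  rewrite /Q !row_mul -[row i (conjmx X)]map_row ra -scalemxAl -row_mul mulmxV // !mxE.
  by rewrite eq_sym (negbTE ji) mulr0.
have /andP[/sub_rVP[l lX] /sub_rVP[a aX]] := sX.
have l0 : l != 0.
  apply/eqP=> l0; have /(congr1 (mulmx^~ (invmx X))) : const_mx 1 *m X = 0 :> 'rV_k.
    by rewrite aX lX l0 scale0r scaler0.
  rewrite mulmxK // mul0mx => /rowP/(_ (Ordinal k0)); rewrite !mxE => /eqP.
  by rewrite oner_eq0.
exists l => //.
(* The extra line makes the remaining entries equal: column [s i] of [Q] is supported in row [i], so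
   its sum [l] is the entry there. *)
have onesQ : (const_mx 1 : 'rV_k) *m Q = l *: const_mx 1.
  rewrite /Q !mulmxA -[X in X *m conjmx _](_ : conjmx (const_mx 1) = _); last first.
    by rewrite /conjmx map_const_mx rmorph1.
  by rewrite -conjmxM lX -scalemxAl mulmxK.
have QX : Q *m X = conjmx X *m K by rewrite mulmxKV.
clearbody Q.
have Qon i : Q i (s i) = l.
  have /rowP/(_ (s i)) := onesQ; rewrite !mxE mulr1 => <-.
  rewrite (bigD1 i) //= mxE mul1r big1 ?addr0 // => t ti.
  by rewrite Qoff ?mulr0 // (inj_eq perm_inj) eq_sym.
have QE : Q = l *: perm_mx s.
  apply/matrixP=> i j; rewrite [RHS]mxE perm_mxEsub !mxE.
  by have [<-|ji] := eqVneq (s i) j; rewrite ?Qon ?mulr1 // Qoff ?mulr0 // eq_sym.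
rewrite -mulmxA scalemxAr scalemxAl -QE.
by rewrite QX mulmxA -conjmxM mulVmx // conjmx1 mul1mx.
Qed.

Lemma CP_of_vector (x : 'rV[C]_k) : x != 0 -> exists p : CP R k, (p == x)%MS.
Proof.
move=> x0; have H : (<<(<<x>>%MS : 'M_k)>>%MS == (<<x>>%MS : 'M_k)) && (\rank (<<x>>%MS : 'M_k) == 1)%N.
  by rewrite genmx_id eqxx genmxE rank_rV x0.
by exists (MkCP H); apply/eqmxP; apply: genmxE.
Qed.

(** The conjugation of [B'] fixes every line of the common form, in particular the rows of [B] and
    their sum; this frame, with the trivial permutation, determines it up to a scalar. *)
Lemma conj_mx_of_unique B B' : (0 < k)%N -> B \in unitmx -> B' \in unitmx ->
  proj_Rform B = proj_Rform B' ->
  exists2 l : C, l != 0 & conj_mx_of B' = l *: conj_mx_of B.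
Proof.
move=> k0 uB uB' BB'.
have fixed (r : 'rV[R]_k) : r != 0 -> forall x, x = map_mx (real_complex R) r *m B ->
    (conjmx x *m conj_mx_of B' == x)%MS.
  move=> r0 x xE; have x0 : x != 0.
    rewrite xE; apply: contra_neq r0 => /(congr1 (mulmx^~ (invmx B))); rewrite mul0mx mulmxK //.
    by move=> /rowP e; apply/rowP=> i; move: (e i); rewrite !mxE => -[].
  have [p px] := CP_of_vector x0.
  have : proj_Rform B' p by rewrite -BB'; exists x => //; split=> //; exists r.
  move/(mem_proj_RformP _ uB')/eqmxP => pK.
  apply/eqmxP; apply: eqmx_trans (eqmxP px); apply: eqmx_trans pK.
  by apply: eqmx_mulr; apply: eqmx_sym; apply/eqmxP; rewrite eqmx_conj.
have [||l l0 lE] := @conj_frame_rigid B (conj_mx_of B') 1 k0 uB.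
- move=> i; rewrite perm1; apply: (fixed (delta_mx 0 i)); last by rewrite rowE map_delta_mx.
  by apply/negP=> /eqP/rowP/(_ i); rewrite !mxE !eqxx => /eqP; rewrite oner_eq0.
- apply: (fixed (const_mx 1)); last by rewrite map_const_mx rmorph1.
  by apply/negP=> /eqP/rowP/(_ (Ordinal k0)); rewrite !mxE => /eqP; rewrite oner_eq0.
by exists l => //; rewrite lE perm_mx1 mulmx1.
Qed.

Lemma eqmx_mul_scale (m r n : nat) (U : 'M[C]_(m, k)) K (l : C) (V : 'M_(n, k)) :
  l != 0 -> (U *m (l *: K) == V)%MS = (U *m K == V)%MS.
Proof. by move=> l0; rewrite -scalemxAr !(eqmx_scale _ l0). Qed.

Lemma hyperbolic_compatibleP B p : B \in unitmx ->
  hyperbolic_compatible (proj_Rform B) p <-> (conjmx p *m conj_mx_of B == p)%MS.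
Proof.
move=> uB; split=> [[B' [uB' BB' H]]|H]; last by exists B; rewrite Rform_conjE.
by apply/(mem_proj_RformP _ uB); rewrite BB'; apply/mem_proj_RformP; rewrite -?Rform_conjE.
Qed.

(** Independence of the chosen basis comes from uniqueness of the conjugation matrix up to a scalar.
    One inclusion of the swap suffices because a conjugation is an involution. *)
Lemma elliptic_compatibleP B p q : B \in unitmx ->
  elliptic_compatible (proj_Rform B) p q <-> (conjmx p *m conj_mx_of B == q)%MS.
Proof.
move=> uB; split=> [[B' [uB' BB' H _]]|H].
  have [l l0 lE] := conj_mx_of_unique (CP_gt0 p) uB uB' BB'.
  by move: H; rewrite Rform_conjE lE eqmx_mul_scale.
exists B; rewrite !Rform_conjE; split; [by []|by []|by []|].
have KK : conjmx (conj_mx_of B) *m conj_mx_of B = 1%:M.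
  rewrite {1}/conj_mx_of conjmxM conjmxK -mulmxA [conjmx B *m _]mulmxA -conjmxM.
  by rewrite mulmxV // conjmx1 mul1mx mulVmx.
apply/eqmxP; rewrite -[X in (_ :=: X)%MS]mulmx1 -KK (mulmxA p); apply: eqmx_mulr.
apply: eqmx_sym; apply/eqmxP; rewrite -[X in (X *m _ == _)%MS](conjmxK p) -conjmxM.
by rewrite eqmx_conj.
Qed.

Lemma conj_mx_ofE B K : B \in unitmx -> conjmx B *m K = B -> conj_mx_of B = K.
Proof.
move=> uB e; rewrite /conj_mx_of -{2}e mulmxA -conjmxM mulVmx //.
by rewrite conjmx1 mul1mx.
Qed.

(** With [P = perm_mx s], a real involution, [M = z + conj z P] satisfies [conj M P = M]: the rows
    of [M *m X] are fixed by the antilinear map [x X |-> conj x P X]. *)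
Lemma conj_mx_exists X s : X \in unitmx -> involutive s ->
  exists2 B, B \in unitmx & conj_mx_of B = conjmx (invmx X) *m perm_mx s *m X.
Proof.
move=> uX sK; have uX' : conjmx X \in unitmx by rewrite conjmx_unit.
have PP : perm_mx s *m perm_mx s = 1%:M :> 'M[C]_k.
  by rewrite -perm_mxM -(perm_mx1 C); congr perm_mx; apply/permP=> i; rewrite permM perm1 sK.
pose z : C := Complex 1 1; pose M : 'M[C]_k := z%:M + z^* *: perm_mx s.
(* This number is the product of [M] with [z - conj z P]; [z = 1 + i] is chosen because its square
   is not real. *)
have zz : z ^+ 2 - (z^*) ^+ 2 != 0.
  by rewrite eq_complex /=; apply/negP=> /andP[_ /eqP]; lra.
have uM : M \in unitmx.
  suff /mulmx1_unit[] : M *m ((z ^+ 2 - (z^*) ^+ 2)^-1 *: (z%:M - z^* *: perm_mx s)) = 1%:M by [].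
  rewrite -scalemxAr mulmxDl !mulmxBr !mul_scalar_mx mul_mx_scalar addrA subrK.
  rewrite -scalemxAl -scalemxAr PP !scalerA -!expr2 -(scalemx1 _ z) scalerA -expr2.
  by rewrite -scalerBl scalerA mulVf // scale1r.
have conjP : conjmx (perm_mx s) = perm_mx s :> 'M[C]_k.
  by rewrite /conjmx map_perm_mx.
have MP : conjmx M *m perm_mx s = M.
  rewrite /conjmx map_mxD map_scalar_mx map_mxZ -/(conjmx _) conjP /= conjCK.
  by rewrite mulmxDl mul_scalar_mx -scalemxAl PP scalemx1 addrC.
exists (M *m X); first by rewrite unitmx_mul uM.
apply: conj_mx_ofE; first by rewrite unitmx_mul uM.
rewrite conjmxM mulmxA (mulmxA (conjmx M *m conjmx X)) -(mulmxA (conjmx M)).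
by rewrite -(conjmxM X) mulmxV // conjmx1 mulmx1 MP.
Qed.

End Rigidity.

(** * Flags of eigendirections, adapted coordinates and cross ratios *)

Section Directions.
Variables (R : realType) (k : nat).
Local Notation C := R[i].

Lemma size_flatten_pairs (T I : Type) (f g : I -> T) (s : seq I) :
  size (flatten [seq [:: f i; g i] | i <- s]) = (2 * size s)%N.
Proof. by elim: s => //= i s ->; lia. Qed.

Lemma nth_flatten_pairs (T I : Type) (x0 : T) (i0 : I) (f g : I -> T) (s : seq I) j :
  (j < size s)%N ->
  nth x0 (flatten [seq [:: f i; g i] | i <- s]) (2 * j) = f (nth i0 s j) /\
  nth x0 (flatten [seq [:: f i; g i] | i <- s]) (2 * j).+1 = g (nth i0 s j).
Proof.
elim: s j => [|i s IHs] [|j] // js.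
have -> : (2 * j.+1 = (2 * j).+2)%N by lia.
exact: (IHs j js).
Qed.

Section OrderedDirs.
Variables (m n : nat) (v vbar : 'I_m -> CP R k) (hyp : 'I_n -> CP R k).
Variable p0 : CP R k.

Lemma size_ordered_dirs : size (ordered_dirs v vbar hyp) = (2 * m + n)%N.
Proof. by rewrite size_cat size_flatten_pairs size_map !size_enum_ord. Qed.

Lemma nth_ordered_dirs_pair (i : 'I_m) :
  nth p0 (ordered_dirs v vbar hyp) (2 * i) = v i /\
  nth p0 (ordered_dirs v vbar hyp) (2 * i).+1 = vbar i.
Proof.
have im := ltn_ord i; rewrite !nth_cat size_flatten_pairs size_enum_ord.
have [|] := @nth_flatten_pairs _ _ p0 i v vbar (enum 'I_m) i; first by rewrite size_enum_ord.
by rewrite nth_ord_enum => -> ->; rewrite !ifT //; lia.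
Qed.

Lemma nth_ordered_dirs_hyp (i : 'I_n) :
  nth p0 (ordered_dirs v vbar hyp) (2 * m + i) = hyp i.
Proof.
rewrite nth_cat size_flatten_pairs size_enum_ord ltnNge leq_addr /= addKn.
by rewrite (nth_map i) ?size_enum_ord // nth_ord_enum.
Qed.

End OrderedDirs.

Lemma sums_seq_sub (l : seq (CP R k)) (r : nat) (V : 'M[C]_(r, k)) :
  (forall p, p \in l -> (p <= V)%MS) -> ((\sum_(p <- l) (p : 'M_k))%MS <= V)%MS.
Proof.
elim: l => [|p l IHl] H; first by rewrite big_nil sub0mx.
rewrite big_cons addsmx_sub H ?mem_head // IHl // => q ql.
by apply: H; rewrite inE ql orbT.
Qed.

Lemma sub_sums_seq (l : seq (CP R k)) p :
  p \in l -> (p <= (\sum_(q <- l) (q : 'M_k))%MS)%MS.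
Proof.
elim: l => // q l IHl; rewrite inE big_cons => /predU1P[->|pl].
  exact: addsmxSl.
exact: submx_trans (IHl pl) (addsmxSr _ _).
Qed.

Variable ds : seq (CP R k).
Hypothesis ds_size : size ds = k.
Local Notation A := (flag_of ds).
Local Notation Cf := (flag_of (rev ds)).
Variable p0 : CP R k.
Local Notation d := (nth p0 ds).

Lemma flag_sub (r : nat) (V : 'M[C]_(r, k)) i :
  (forall s, (s < i)%N -> (s < k)%N -> (d s <= V)%MS) -> (A i <= V)%MS.
Proof.
move=> H; apply: sums_seq_sub => p /(nthP p0)[s]; rewrite size_take ds_size => sk <-.
have [si sk'] : (s < i)%N /\ (s < k)%N by move: sk; case: (ltnP i k); lia.
by rewrite nth_take //; apply: H.
Qed.

Lemma rev_flag_sub (r : nat) (V : 'M[C]_(r, k)) i :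
  (forall s, (k - i <= s)%N -> (s < k)%N -> (d s <= V)%MS) -> (Cf i <= V)%MS.
Proof.
move=> H; apply: sums_seq_sub => p; rewrite take_rev mem_rev => /(nthP p0)[s].
rewrite size_drop ds_size => sk <-; rewrite nth_drop; apply: H; lia.
Qed.

Lemma sub_flag i s : (s < i)%N -> (s < k)%N -> (d s <= A i)%MS.
Proof.
move=> si sk; apply: sub_sums_seq; rewrite -(nth_take p0 si).
by apply: mem_nth; rewrite size_take ds_size; case: ifP.
Qed.

Lemma sub_rev_flag i s : (k - i <= s)%N -> (s < k)%N -> (d s <= Cf i)%MS.
Proof.
move=> si sk; apply: sub_sums_seq; rewrite take_rev mem_rev ds_size.
rewrite -(subnKC si) -nth_drop; apply: mem_nth; rewrite size_drop ds_size; lia.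
Qed.

Lemma generic_full_flags (h : CP R k) i j : (i + j = k)%N ->
  generic_position [:: A; Cf; line_flag h] -> row_full (A i + Cf j)%MS.
Proof.
(* The index 0 for the line selects its zero member, so that only the two flags contribute. *)
move=> ijk G; have [||_] := G (fun s => nth 0%N [:: i; j; 0%N] s).
- case=> [[|[|[|]]] H] //=; rewrite ?size_rev ds_size; lia.
- by rewrite !big_ord_recl big_ord0 /=; lia.
rewrite !big_ord_recl big_ord0 -!sub1mx => /submx_trans; apply.
by rewrite /tnth /= !addsmx_sub addsmxSl addsmxSr !sub0mx.
Qed.

Lemma generic_full_line (h : CP R k) i j : ((i + j).+1 = k)%N ->
  generic_position [:: A; Cf; line_flag h] -> row_full (A i + Cf j + h)%MS.
Proof.
move=> ijk G; have [||_] := G (fun s => nth 0%N [:: i; j; 1%N] s).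
- case=> [[|[|[|]]] H] //=; rewrite ?size_rev ds_size; lia.
- by rewrite !big_ord_recl big_ord0 /=; lia.
rewrite !big_ord_recl big_ord0 -!sub1mx => /submx_trans; apply.
rewrite /tnth /= !addsmx_sub sub0mx andbT -addsmxA addsmxSl /=.
by rewrite addsmxC -addsmxA addsmxSl addsmxC -addsmxA addsmxSl.
Qed.

Lemma generic_full_line4 (b h : CP R k) i j : ((i + j).+1 = k)%N ->
  generic_position [:: A; line_flag b; Cf; line_flag h] ->
  row_full (A i + Cf j + b)%MS.
Proof.
move=> ijk G; have [||_] := G (fun s => nth 0%N [:: i; 1%N; j; 0%N] s).
- case=> [[|[|[|[|]]]] H] //=; rewrite ?size_rev ds_size; lia.
- by rewrite !big_ord_recl big_ord0 /=; lia.
rewrite !big_ord_recl big_ord0 -!sub1mx => /submx_trans; apply.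
rewrite /tnth /= !addsmx_sub !sub0mx !andbT.
apply/and3P; split; last exact: submx_trans (addsmxSr _ _) (addsmxSl _ _).
  exact: submx_trans (addsmxSl _ _) (addsmxSl _ _).
exact: addsmxSr.
Qed.

Lemma nz_row_functional (p : CP R k) (w : 'cV[C]_k) :
  (nz_row p *m w == 0) = (p <= kermx w)%MS.
Proof. by rewrite sub_kermx -!submx0 (eqmx_mulr w (CP_nz_row p)) . Qed.

Lemma full_functional (r : nat) (U : 'M[C]_(r, k)) (w : 'cV[C]_k) :
  row_full U -> (U <= kermx w)%MS -> w = 0.
Proof.
rewrite -sub1mx => U1 /(submx_trans U1); rewrite sub_kermx mul1mx.
by move/eqP.
Qed.

(** The [i]-th coordinate functional kills every [d s] with [s != i]. If it also killed [b], it
    would vanish on [A i + Cf (k - i.+1) + b], which is the whole space. *)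
Lemma coord_neq0 (E : 'M[C]_k) (b : CP R k) (i : 'I_k) : E \in unitmx ->
  (forall t : 'I_k, (d t :=: row t E)%MS) ->
  row_full (A i + Cf (k - i.+1)%N + b)%MS -> (nz_row b *m invmx E) 0 i != 0.
Proof.
move=> uE Ed full; apply/eqP=> bi0; pose w : 'cV[C]_k := invmx E *m delta_mx i 0.
have Ew : E *m w = delta_mx i 0 by rewrite mulKVmx.
suff w0 : w = 0.
  by have /matrixP/(_ i 0) := Ew; rewrite w0 mulmx0 !mxE !eqxx => /eqP; rewrite eq_sym oner_eq0.
apply: (full_functional full).
have kill s : (s < k)%N -> s != i -> (d s <= kermx w)%MS.
  move=> sk si; rewrite (Ed (Ordinal sk)) sub_kermx -row_mul Ew.
  by apply/eqP/rowP=> a; rewrite !mxE -val_eqE /= (negbTE si).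
rewrite !addsmx_sub -andbA; apply/and3P; split.
- by apply: flag_sub => s si sk; apply: kill => //; lia.
- by apply: rev_flag_sub => s si sk; apply: kill => //; lia.
rewrite -nz_row_functional; apply/eqP/rowP=> a; rewrite ord1.
by rewrite mulmxA -colE [LHS]mxE bi0 mxE.
Qed.

(** Genericity makes every coordinate of [h] nonzero in a basis of generators of the directions, so
    each generator can be rescaled by the corresponding coordinate. *)
Lemma adapted_basis (h : CP R k) :
  generic_position [:: A; Cf; line_flag h] ->
  exists2 E : 'M[C]_k, E \in unitmx &
    (forall i : 'I_k, (d i :=: row i E)%MS) /\ nz_row h = const_mx 1 *m E.
Proof.
move=> G; pose N : 'M[C]_k := \matrix_(i < k) nz_row (d i).
have Nd (i : 'I_k) : (d i :=: row i N)%MS by rewrite rowK; apply: CP_nz_row.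
have dN s : (s < k)%N -> (d s <= N)%MS.
  by move=> sk; rewrite (Nd (Ordinal sk)) row_sub.
have uN : N \in unitmx.
  rewrite -row_full_unit -sub1mx; have := generic_full_flags (addn0 k) G.
  rewrite -sub1mx => /submx_trans; apply; rewrite addsmx_sub.
  by apply/andP; split; [apply: flag_sub|apply: rev_flag_sub] => s _; apply: dN.
pose x := nz_row h *m invmx N.
have xN : x *m N = nz_row h by rewrite mulmxKV.
have x0 i : x 0 i != 0.
  apply: (coord_neq0 uN Nd); apply: (generic_full_line _ G).
  by have := ltn_ord i; lia.
clearbody x.
exists (diag_mx x *m N).
  rewrite unitmx_mul uN andbT unitmxE det_diag unitfE.
  by apply/prodf_neq0 => i _; apply: x0.
split=> [i|].
  apply: eqmx_trans (Nd i) _; rewrite row_mul row_diag_mx -scalemxAl -rowE.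
  by apply: eqmx_sym; apply: eqmx_scale.
rewrite mulmxA -xN; congr (_ *m _); apply/rowP=> i.
rewrite !mxE (bigD1 i) //= !mxE eqxx mul1r big1 ?addr0 // => j ji.
by rewrite !mxE (negbTE ji) mulr0.
Qed.

Lemma rank_sums_seq (l : seq (CP R k)) :
  (\rank (\sum_(p <- l) (p : 'M_k))%MS <= size l)%N.
Proof.
elim: l => [|p l IHl]; first by rewrite big_nil mxrank0.
rewrite big_cons; have [le _] := mxrank_adds_leqif (p : 'M_k) (\sum_(p <- l) (p : 'M_k))%MS.
by rewrite (leq_trans le) // CP_rank1 add1n ltnS.
Qed.

Lemma det_rows2 (u w : 'rV[C]_2) :
  \det (\matrix_(i < 2) (if i == 0 then u else w) : 'M_2) =
    u 0 0 * w 0 1 - u 0 1 * w 0 0.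
Proof.
rewrite (expand_det_row _ 0) !big_ord_recl big_ord0 /cofactor !det_mx11 !mxE /=.
have e1 : lift ord0 ord0 = 1 :> 'I_2 by apply: val_inj.
have e2 : lift 0 0 = 1 :> 'I_2 by apply: val_inj.
have e3 : lift 1 0 = 0 :> 'I_2 by apply: val_inj.
by rewrite !e1 ?e2 ?e3 expr0 expr1 mul1r mulN1r mulrN addr0.
Qed.

(** Every difference is a multiple of the determinant [D] of [u] and [w]; both [D] and the scalars
    of the representatives cancel, leaving the cross ratio of [1:0], [x:y], [0:1] and [1:1]. *)
Lemma cross_ratio_rV_coord (u w : 'rV[C]_2) (a1 a2 a3 a4 x y : C) :
  u 0 0 * w 0 1 - u 0 1 * w 0 0 != 0 -> a1 != 0 -> a2 != 0 -> a3 != 0 ->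
  a4 != 0 ->
  cross_ratio_rV (a1 *: u) (a2 *: (x *: u + y *: w)) (a3 *: w) (a4 *: (u + w))
    = x / y.
Proof.
rewrite /cross_ratio_rV !mxE; set D := (X in X != 0).
move=> D0 a10 a20 a30 a40.
have -> : a1 * u 0 0 * (a4 * (u 0 1 + w 0 1)) - a1 * u 0 1 * (a4 * (u 0 0 + w 0 0))
    = a1 * a4 * D by rewrite /D; ring.
have -> : a3 * w 0 0 * (a2 * (x * u 0 1 + y * w 0 1)) - a3 * w 0 1 * (a2 * (x * u 0 0 + y * w 0 0))
    = - (a3 * a2 * x * D) by rewrite /D; ring.
have -> : a1 * u 0 0 * (a2 * (x * u 0 1 + y * w 0 1)) - a1 * u 0 1 * (a2 * (x * u 0 0 + y * w 0 0))
    = a1 * a2 * y * D by rewrite /D; ring.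
have -> : a3 * w 0 0 * (a4 * (u 0 1 + w 0 1)) - a3 * w 0 1 * (a4 * (u 0 0 + w 0 0))
    = - (a3 * a4 * D) by rewrite /D; ring.
clearbody D.
(* For [y = 0] both sides are 0, by the convention that the inverse of 0 is 0. *)
have [->|y0] := eqVneq y 0; first by rewrite !(mulr0, mul0r, invr0).
by field; rewrite D0 a10 a20 a30 a40 y0.
Qed.

(** The quotient by [W] kills all basis vectors except those at [i0] and [i1], with images [u] and
    [w]; the four lines become those of [u], [beta_i0 u + beta_i1 w], [w] and [u + w]. *)
Lemma proj_cross_ratioE (E : 'M[C]_k) (b h : CP R k) (i0 i1 : 'I_k) :
  E \in unitmx -> (forall t : 'I_k, (d t :=: row t E)%MS) ->
  nz_row h = const_mx 1 *m E -> i1 = i0.+1 :> nat ->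
  let beta := nz_row b *m invmx E in beta 0 i0 != 0 ->
  proj_cross_ratio A Cf h b i0 (k - 2 - i0) = beta 0 i0 / beta 0 i1.
Proof.
move=> uE Ed hE i01 beta b0; have i1k := ltn_ord i1.
rewrite /proj_cross_ratio; set W := (A i0 + Cf _)%MS.
(* Positions below [i0] lie in the first flag, and [Cf (k - 2 - i0)] starts at position [i0 + 2],
   just after [i1]. *)
have dW t : t != i0 -> t != i1 -> (row t E <= W)%MS.
  rewrite -!val_eqE /= => t0 t1; rewrite -(Ed t); have tk := ltn_ord t.
  have [ti|ti] := ltnP t i0.
    exact: submx_trans (sub_flag ti tk) (addsmxSl _ _).
  by apply: submx_trans (addsmxSr _ _); apply: sub_rev_flag => //; lia.
(* The upper bound counts the [k - 2] generating lines of [W]; the lower one holds because two more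
   rows complete [W] to the whole space. *)
have rW : (\rank W + 2 = k)%N.
  apply/eqP; rewrite eqn_leq; apply/andP; split.
    have [le _] := mxrank_adds_leqif (A i0) (Cf (k - 2 - i0)%N).
    have leA : (\rank (A i0) <= i0)%N.
      by apply: leq_trans (rank_sums_seq _) _; rewrite size_take_min geq_minl.
    have leC : (\rank (Cf (k - 2 - i0)%N) <= k - 2 - i0)%N.
      by apply: leq_trans (rank_sums_seq _) _; rewrite size_take_min geq_minl.
    apply: leq_trans (leq_add (leq_trans le (leq_add leA leC)) (leqnn 2)) _; lia.
  have : (E <= W + (row i0 E + row i1 E))%MS.
    apply/row_subP=> t; have [->|t0] := eqVneq t i0.
      exact: submx_trans (addsmxSl _ _) (addsmxSr _ _).
    have [->|t1] := eqVneq t i1; first exact: submx_trans (addsmxSr _ _) (addsmxSr _ _).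
    exact: submx_trans (dW t t0 t1) (addsmxSl _ _).
  move/mxrankS; rewrite mxrank_unit // => /leq_trans; apply.
  have [le _] := mxrank_adds_leqif W (row i0 E + row i1 E)%MS.
  apply: leq_trans le _; rewrite leq_add2l.
  have [le _] := mxrank_adds_leqif (row i0 E) (row i1 E).
  by apply: leq_trans le _; apply: (@leq_add _ _ 1 1); apply: rank_leq_row.
have [rQ kerQ] := quot2P rW; move: (quot2 W) rQ kerQ => Q rQ kerQ.
have WQ : W *m Q = 0 by apply/eqP; rewrite kerQ.
set u := row i0 E *m Q; set w := row i1 E *m Q.
have vecE (x : 'rV[C]_k) : x *m E *m Q = x 0 i0 *: u + x 0 i1 *: w.
  rewrite (mulmx_sum_row x E) mulmx_suml (bigD1 i0) //= (bigD1 i1) /=; last first.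
    by rewrite -val_eqE /= i01 neq_ltn ltnSn orbT.
  rewrite -!scalemxAl big1 ?addr0 // => t /andP[t0 t1].
  by rewrite -scalemxAl; apply/eqP; rewrite scaler_eq0 kerQ dW // orbT.
(* [u] and [w] span the row space of [Q], which has rank 2, so their determinant is nonzero. *)
have uw0 : u 0 0 * w 0 1 - u 0 1 * w 0 0 != 0.
  pose M : 'M[C]_2 := \matrix_(i < 2) (if i == 0 then u else w).
  have uM : (u <= M)%MS by rewrite (_ : u = row 0 M) ?row_sub // rowK.
  have wM : (w <= M)%MS by rewrite (_ : w = row 1 M) ?row_sub // rowK.
  have : (Q <= M)%MS.
    apply/row_subP=> t; rewrite -[Q](mulKmx uE) row_mul mulmxA vecE.
    by rewrite addmx_sub // scalemx_sub.
  move/mxrankS; rewrite rQ => r2.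
  have : M \in unitmx by rewrite -row_free_unit /row_free eqn_leq rank_leq_row.
  by rewrite unitmxE unitfE det_rows2.
(* When [U] is generated by [x] modulo [W], the representative used by the cross ratio is a nonzero
   multiple of the image of [x]. *)
have im (U : 'M[C]_k) (x : 'rV[C]_k) : (U <= x + W)%MS -> (x <= U)%MS -> x *m Q != 0 ->
    exists2 a, a != 0 & nz_row (U *m Q) = a *: (x *m Q).
  move=> Ux xU xQ; have /sub_rVP[a aE] : (nz_row (U *m Q) <= x *m Q)%MS.
    apply: submx_trans (nz_row_sub _) _; apply: submx_trans (submxMr Q Ux) _.
    by rewrite addsmxMr WQ addsmx0 submx_refl.
  exists a => //; apply: contraNneq xQ => a0.
  have : nz_row (U *m Q) == 0 by rewrite aE a0 scale0r.
  by rewrite nz_row_eq0 !kerQ; apply: submx_trans.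
have u0 : u != 0 by apply: contraNneq uw0 => ->; rewrite !mxE !mul0r subrr.
have w0 : w != 0 by apply: contraNneq uw0 => ->; rewrite !mxE !mulr0 subrr.
have hQ : nz_row h *m Q = u + w by rewrite hE vecE !mxE !scale1r.
have bQ : nz_row b *m Q = beta 0 i0 *: u + beta 0 i1 *: w.
  by rewrite -vecE /beta mulmxKV.
have indep (x y : C) : x != 0 -> x *: u + y *: w != 0.
  move=> x0; apply: contraNneq uw0 => e.
  have e0 : x * u 0 0 + y * w 0 0 = 0 by move/rowP/(_ 0): e; rewrite !mxE.
  have e1 : x * u 0 1 + y * w 0 1 = 0 by move/rowP/(_ 1): e; rewrite !mxE.
  rewrite -(inj_eq (mulfI x0)) mulr0.
  have -> : x * (u 0 0 * w 0 1 - u 0 1 * w 0 0) =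
    (x * u 0 0 + y * w 0 0) * w 0 1 - (x * u 0 1 + y * w 0 1) * w 0 0 by ring.
  by rewrite e0 e1 !mul0r subrr.
have [a1 a10 a1E] : exists2 a, a != 0 & nz_row ((A i0.+1 + Cf (k - 2 - i0)%N)%MS *m Q) = a *: u.
  apply: im => //; last by rewrite -(Ed i0) (submx_trans _ (addsmxSl _ _)) // sub_flag.
  rewrite addsmx_sub (submx_trans (addsmxSr _ _) (addsmxSr _ _)) andbT.
  apply: flag_sub => s; rewrite ltnS leq_eqVlt => /predU1P[->|si] sk.
    by rewrite (Ed i0) addsmxSl.
  apply: submx_trans (addsmxSr _ _); apply: submx_trans (addsmxSl _ _).
  exact: sub_flag.
(* One step further, the reversed flag starts at position [i0 + 1 = i1], so only the row at [i1] is
   added to [W]. *)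
have [a3 a30 a3E] : exists2 a, a != 0 & nz_row ((A i0 + Cf (k - 2 - i0).+1)%MS *m Q) = a *: w.
  apply: im => //; last first.
    by rewrite -(Ed i1) (submx_trans _ (addsmxSr _ _)) // sub_rev_flag //; lia.
  rewrite addsmx_sub (submx_trans (addsmxSl _ _) (addsmxSr _ _)) /=.
  apply: rev_flag_sub => s si sk; have [si1|si1] := eqVneq s (i1 : nat).
    by rewrite si1 (Ed i1) addsmxSl.
  apply: submx_trans (addsmxSr _ _); apply: submx_trans (addsmxSr _ _).
  by apply: sub_rev_flag => //; lia.
have [a2 a20 a2E] : exists2 a, a != 0 & nz_row ((b + W)%MS *m Q) = a *: (nz_row b *m Q).
  apply: im; first by rewrite addsmx_sub addsmxSr (CP_nz_row b) addsmxSl.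
    by rewrite -(CP_nz_row b) addsmxSl.
  by rewrite bQ indep.
have [a4 a40 a4E] : exists2 a, a != 0 & nz_row ((h + W)%MS *m Q) = a *: (nz_row h *m Q).
  apply: im; first by rewrite addsmx_sub addsmxSr (CP_nz_row h) addsmxSl.
    by rewrite -(CP_nz_row h) addsmxSl.
  by rewrite hQ -[u]scale1r -[w]scale1r indep ?oner_eq0.
rewrite /cross_ratio a1E a2E a3E a4E bQ hQ; exact: cross_ratio_rV_coord.
Qed.

End Directions.

(** * The form preserved by the eigendirections, in adapted coordinates *)

Section PreservedForm.
Variables (R : realType) (m n : nat).
Local Notation C := R[i].
Local Notation k := (2 * m + n)%N.
Variables (v vbar : 'I_m -> CP R k) (hyp : 'I_n -> CP R k) (h : CP R k).

Definition partner_ord (i : 'I_k) : 'I_k := Ordinal (partner_lt (ltn_ord i)).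

Lemma partner_ordK : involutive partner_ord.
Proof. by move=> i; apply: val_inj; rewrite /= partnerK. Qed.

Definition partner_perm : 'S_k := perm (inv_inj partner_ordK).

Lemma partner_permE i : partner_perm i = partner_ord i.
Proof. by rewrite permE. Qed.

Lemma partner_permK : involutive partner_perm.
Proof. by move=> i; rewrite !partner_permE partner_ordK. Qed.

Local Notation ds := (ordered_dirs v vbar hyp).
Local Notation d := (nth h ds).

(** Merges the elliptic and hyperbolic conditions into a single one indexed by position, the form
    required by frame rigidity; a hyperbolic position is a fixed point of [partner_perm]. *)
Lemma preserved_RformP (B : 'M[C]_k) : B \in unitmx ->
  preserved_Rform v vbar hyp h (proj_Rform B) <->
  (forall i : 'I_k, conjmx (d i) *m conj_mx_of B == d (partner_perm i))%MS /\
  (conjmx h *m conj_mx_of B == h)%MS.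
Proof.
move=> uB; split=> [[_ Hv Hh /(hyperbolic_compatibleP _ uB) Hp]|[Hd Hh]]; last first.
  split=> [|i|i|]; first by exists B.
  - apply/(elliptic_compatibleP _ _ uB).
    have [ve vo] := nth_ordered_dirs_pair v vbar hyp h i.
    have ik : (2 * i < k)%N by have := ltn_ord i; lia.
    have := Hd (Ordinal ik); rewrite partner_permE /= partner_even ?ve ?vo //.
      by have := ltn_ord i; lia.
    by rewrite oddM.
  - apply/(hyperbolic_compatibleP _ uB).
    have ik : (2 * m + i < k)%N by rewrite ltn_add2l.
    have := Hd (Ordinal ik); rewrite partner_permE /= partner_big ?leq_addr //.
    by rewrite nth_ordered_dirs_hyp.
  - exact/(hyperbolic_compatibleP _ uB).
split=> // i; rewrite partner_permE /=; have ik := ltn_ord i.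
have [im|im] := leqP (2 * m) i.
  have jn : (i - 2 * m < n)%N by lia.
  have := nth_ordered_dirs_hyp v vbar hyp h (Ordinal jn); rewrite /= subnKC // => e.
  by rewrite partner_big // e; apply/(hyperbolic_compatibleP _ uB).
have jm : (i./2 < m)%N by lia.
have [a ae] : exists a : 'I_m, nat_of_ord i = (2 * a)%N \/ nat_of_ord i = (2 * a).+1.
  by exists (Ordinal jm) => /=; lia.
have [ve vo] := nth_ordered_dirs_pair v vbar hyp h a.
have am := ltn_ord a; have o2 : ~~ odd (2 * a) by rewrite oddM.
have Ha := Hv a; case: ae => ->.
  by rewrite partner_even ?ve ?vo //; [apply/(elliptic_compatibleP _ _ uB)|lia].
rewrite partner_odd ?ve ?vo //; last lia.
by apply/(elliptic_compatibleP _ _ uB); case: Ha => B' [? ? ? ?]; exists B'.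
Qed.

Variable E : 'M[C]_k.
Hypothesis uE : E \in unitmx.
Hypothesis Ed : forall i : 'I_k, (d i :=: row i E)%MS.
Hypothesis hE : nz_row h = const_mx 1 *m E.

(** The matrix, in standard coordinates, of the antilinear map that conjugates the coordinates in
    the basis [E] and exchanges those of partners. *)
Definition swap_mx : 'M[C]_k := conjmx (invmx E) *m perm_mx partner_perm *m E.

Lemma conj_swap (r : nat) (x : 'M[C]_(r, k)) :
  conjmx (x *m E) *m swap_mx = conjmx x *m perm_mx partner_perm *m E.
Proof.
rewrite /swap_mx conjmxM mulmxA (mulmxA (conjmx x *m conjmx E)).
by rewrite -(mulmxA (conjmx x)) -(conjmxM E) mulmxV // conjmx1 mulmx1.
Qed.

Lemma mul_partner_perm (x : 'rV[C]_k) (t : 'I_k) :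
  (x *m perm_mx partner_perm) 0 t = x 0 (partner_perm t).
Proof.
have sV : partner_perm = (partner_perm^-1)%g.
  by apply/permP=> i; apply: (@perm_inj _ partner_perm); rewrite permKV partner_permK.
by rewrite {1}sV -col_permE mxE.
Qed.

(** The rows of [E] and their sum, which generates [h], form a projective frame, so rigidity yields
    one direction; conversely [swap_mx] permutes these lines as prescribed, and a nonzero scalar
    does not change images of lines. *)
Lemma preserved_swap (B : 'M[C]_k) : B \in unitmx ->
  preserved_Rform v vbar hyp h (proj_Rform B) <->
  exists2 l, l != 0 & conj_mx_of B = l *: swap_mx.
Proof.
move=> uB; apply: (iff_trans (preserved_RformP uB)).
have eqd (p q : 'rV[C]_k) (P Q : 'M[C]_k) (K : 'M[C]_k) : (P :=: p)%MS -> (Q :=: q)%MS ->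
    (conjmx P *m K == Q)%MS = (conjmx p *m K == q)%MS.
  move=> Pp Qq; have e : (conjmx P *m K :=: conjmx p *m K)%MS.
    by apply: eqmx_mulr; apply/eqmxP; rewrite eqmx_conj; apply/eqmxP.
  by rewrite !e !Qq.
split=> [[Hd Hh]|[l l0 ->]].
  apply: conj_frame_rigid => //; first exact: CP_gt0 h.
    by move=> i; rewrite -(eqd _ _ _ _ _ (Ed i) (Ed _)).
  by rewrite -hE -(eqd _ _ _ _ _ (CP_nz_row h) (CP_nz_row h)).
split=> [i|].
  rewrite (eqd _ _ _ _ _ (Ed i) (Ed _)) eqmx_mul_scale // !rowE conj_swap.
  apply/eqmxP; rewrite (_ : conjmx _ *m _ = delta_mx 0 (partner_perm i)); first exact: eqmx_refl.
  apply/rowP=> t; rewrite mul_partner_perm !mxE -[t in RHS]partner_permK.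
  by rewrite (inj_eq perm_inj) eqxx; case: eqP; rewrite ?rmorph1 ?rmorph0.
rewrite (eqd _ _ _ _ _ (CP_nz_row h) (CP_nz_row h)) eqmx_mul_scale // hE conj_swap.
apply/eqmxP; rewrite (_ : conjmx _ *m _ = const_mx 1); first exact: eqmx_refl.
by apply/rowP=> t; rewrite mul_partner_perm !mxE rmorph1.
Qed.

(** Extended by 0 beyond [k] so as to be indexed by natural numbers, as in the numerical
    criteria. *)
Definition coord (b : CP R k) (s : nat) : C :=
  if insub s is Some i then (nz_row b *m invmx E) 0 i else 0.

Lemma coord_ord b (i : 'I_k) : coord b i = (nz_row b *m invmx E) 0 i.
Proof. by rewrite /coord valK. Qed.

(** Two vectors span the same line when one is a nonzero multiple of the other; as no coordinate
    vanishes, this is constancy of the entrywise quotients, and the constant is itself nonzero. *)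
Lemma swap_coordP (b b' : CP R k) :
  (forall s, (s < k)%N -> coord b s != 0) ->
  (forall s, (s < k)%N -> coord b' s != 0) ->
  (conjmx b *m swap_mx == b')%MS <->
  exists l, forall s, (s < k)%N -> (coord b (partner m s))^* / coord b' s = l.
Proof.
move=> b0 b'0; set x := nz_row b *m invmx E; set y := nz_row b' *m invmx E.
have xE : nz_row b = x *m E by rewrite mulmxKV.
have yE : nz_row b' = y *m E by rewrite mulmxKV.
have e : (conjmx b *m swap_mx :=: conjmx x *m perm_mx partner_perm *m E)%MS.
  rewrite -conj_swap -xE; apply: eqmx_mulr; apply/eqmxP; rewrite eqmx_conj.
  exact/eqmxP/CP_nz_row.
have entry l : (conjmx x *m perm_mx partner_perm *m E = l *: (y *m E)) <->
    forall s, (s < k)%N -> (coord b (partner m s))^* = l * coord b' s.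
  rewrite scalemxAl; split=> [/(can_inj (mulmxK uE))/rowP H s sk|H].
    have := H (Ordinal sk); rewrite mul_partner_perm partner_permE [LHS]mxE [RHS]mxE.
    by rewrite -!coord_ord.
  congr (_ *m _); apply/rowP=> t; rewrite mul_partner_perm partner_permE.
  by rewrite [LHS]mxE [RHS]mxE -!coord_ord; apply: H (ltn_ord t).
split=> [/andP[]|[l H]].
  move=> + _; rewrite e (CP_nz_row b') yE => /sub_rVP[l /entry H].
  by exists l => s sk; rewrite H // mulfK ?b'0.
have {}H s : (s < k)%N -> (coord b (partner m s))^* = l * coord b' s.
  by move=> sk; rewrite -(H s sk) divfK // b'0.
have k0 := CP_gt0 h; have l0 : l != 0.
  apply/eqP=> l0; have := H 0%N k0; rewrite l0 mul0r => /eqP.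
  by rewrite conjC_eq0 (negbTE (b0 _ _)) // partner_lt.
have /entry eq := H; apply/eqmxP; apply: eqmx_trans e _; rewrite eq -yE.
by apply: eqmx_trans (eqmx_scale _ l0) (eqmx_sym (CP_nz_row b')).
Qed.



Hypothesis hgen : generic_position [:: flag_of ds; flag_of (rev ds); line_flag h].

Lemma coord_generic_neq0 (b : CP R k) :
  generic_position [:: flag_of ds; line_flag b; flag_of (rev ds); line_flag h] ->
  forall s, (s < k)%N -> coord b s != 0.
Proof.
move=> G s sk; rewrite (coord_ord b (Ordinal sk)).
have dsk : size ds = k by apply: size_ordered_dirs.
apply: (coord_neq0 dsk uE Ed); apply: (generic_full_line4 dsk _ G).
by rewrite /=; lia.
Qed.

Lemma cross_ratio_coord (b : CP R k) s :
  coord b s != 0 -> (s.+1 < k)%N ->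
  proj_cross_ratio (flag_of ds) (flag_of (rev ds)) h b s (k - 2 - s) =
    coord b s / coord b s.+1.
Proof.
move=> b0 sk; have dsk : size ds = k by apply: size_ordered_dirs.
rewrite (coord_ord b (Ordinal (ltnW sk))) in b0 *.
rewrite (coord_ord b (Ordinal sk)).
exact: (proj_cross_ratioE dsk uE Ed hE (i0 := Ordinal (ltnW sk)) (i1 := Ordinal sk)).
Qed.

End PreservedForm.

Theorem theorem10 (R : realType) (k m n : nat) (hk : (2 * m + n)%N = k)
    (v vbar : 'I_m -> CP R k) (hyp : 'I_n -> CP R k)
    (hsys : eigendirection_system v vbar hyp) (h : CP R k)
    (hh : hyperbolic_eigendirection h)
    (hgen : generic_position [:: flag_of (ordered_dirs v vbar hyp);
                                 flag_of (rev (ordered_dirs v vbar hyp));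
                                 line_flag h]) :
  let A := flag_of (ordered_dirs v vbar hyp) in
  let C := flag_of (rev (ordered_dirs v vbar hyp)) in
  let D := line_flag h in
  let c (b : CP R k) (j : nat) := proj_cross_ratio A C h b j (k - 2 - j) in
  exists F : set (CP R k),
    [/\ unique (preserved_Rform v vbar hyp h) F,
      forall b : CP R k,
        hyperbolic_eigendirection b ->
        generic_position [:: A; line_flag b; C; D] ->
        (hyperbolic_compatible F b <->
          [/\ forall j, ~~ odd j -> (j < 2 * m)%N -> `|c b j| = 1,
              forall j, ~~ odd j -> (j < 2 * m)%N -> (j + 2 <> 2 * m)%N ->
                exists z : int,
                  carg (c b j) + 2 * carg (c b j.+1) + carg (c b j.+2)
                    = z%:~R * (2 * pi),
              forall j, (2 * m <= j)%N -> (j + 2 <= k)%N ->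
                c b j \is Num.real &
              forall j, (j + 2 = 2 * m)%N -> (0 < n)%N ->
                exists z : int,
                  carg (c b j) + 2 * carg (c b j.+1) = z%:~R * (2 * pi)]) &
      forall b b' : CP R k,
        elliptic_eigendirection_pair b b' ->
        generic_position [:: A; line_flag b; C; D] ->
        generic_position [:: A; line_flag b'; C; D] ->
        (elliptic_compatible F b b' <->
          [/\ forall j, ~~ odd j -> (j < 2 * m)%N -> c b j * (c b' j)^* = 1,
              forall j, odd j -> (j < 2 * m)%N -> (j + 1 <> 2 * m)%N ->
                c b j = (c b' j.-1 * c b' j * c b' j.+1)^*,
              forall j, (2 * m <= j)%N -> (j + 2 <= k)%N ->
                c b j = (c b' j)^* &
              forall j, (j + 1 = 2 * m)%N -> (0 < n)%N ->
                c b' j = (c b j.-1 * c b j)^*])].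
Proof.
move=> A Cf D c; subst k.
have dsk : size (ordered_dirs v vbar hyp) = (2 * m + n)%N by apply: size_ordered_dirs.
have [E uE [Ed hE]] := adapted_basis dsk h hgen.
(* Existence of the form: a basis [B] whose conjugation matrix is exactly [swap_mx E]. *)
have [B uB KB] := conj_mx_exists uE (@partner_permK m n).
have swapB b b' : (conjmx b *m conj_mx_of B == b')%MS = (conjmx b *m swap_mx E == b')%MS.
  by rewrite KB.
have bc b : generic_position [:: A; line_flag b; Cf; D] ->
    forall s, (s < 2 * m + n)%N -> coord E b s != 0 by apply: coord_generic_neq0.
have cE b : generic_position [:: A; line_flag b; Cf; D] ->
    forall s, (s.+1 < 2 * m + n)%N -> c b s = coord E b s / coord E b s.+1.
  by move=> G s sk; apply: cross_ratio_coord => //; apply: bc => //; apply: ltnW.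
exists (proj_Rform B); split=> [|b _ G|b b' _ G G'].
- split; first by apply/(preserved_swap uE Ed hE uB); exists 1; rewrite ?oner_eq0 // scale1r KB.
  (* Uniqueness: any other preserved form has a conjugation matrix proportional to that of [B], and
     a form is the set of lines fixed by its conjugation. *)
  move=> F' HF'; have [[B' uB' F'E] _ _ _] := HF'.
  move: HF'; rewrite F'E => /(preserved_swap uE Ed hE uB')[l l0 lE].
  apply/seteqP; split=> p /mem_proj_RformP H; apply/mem_proj_RformP => //; move: H.
    by rewrite lE KB eqmx_mul_scale //; apply.
  by rewrite lE KB eqmx_mul_scale //; apply.
- apply: (iff_trans (hyperbolic_compatibleP b uB)); rewrite swapB.
  (* Fixing a line is the case where source and target of the conjugation coincide, so both
     coordinate vectors are that of [b]. *)
  apply: (iff_trans (swap_coordP h uE (bc b G) (bc b G))).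
  exact: self_partner_conj_criterion (bc b G) (cE b G).
apply: (iff_trans (elliptic_compatibleP b b' uB)); rewrite swapB.
apply: (iff_trans (swap_coordP h uE (bc b G) (bc b' G'))).
exact: conj_partner_criterion (bc b G) (bc b' G') (cE b G) (cE b' G').
Qed.
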